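(* Let $\Gamma$ be a finitely generated residually finite group and let $\Lambda\le\Gamma$ be a subgroup with $[\Gamma:\Lambda]<\infty$. Let $(N_k)_{k\in\mathbb{N}}$ be a Farber sequence of $\Gamma$ with $N_k\le\Lambda$ for all $k$ and $[\Gamma:N_k]\to\infty$. Let $S$ and $S'$ be finite generating sets of $\Gamma$ and $\Lambda$ respectively, and put $\mathcal{G}=\{Sch(\Gamma,N_k,S)\}_{k\in\mathbb{N}}$ and $\mathcal{H}=\{Sch(\Lambda,N_k,S')\}_{k\in\mathbb{N}}$. Then $$[\Gamma:\Lambda]\,(c(\mathcal{G})-1)=c(\mathcal{H})-1.$$
   Context: A graph sequence $\mathcal{G}=\{G_n\}_{n\in\mathbb{N}}$ is a sequence of finite connected graphs whose vertex degrees are bounded by a constant $d$ independent of $n$, with $\lim_{n\to\infty}|V(G_n)|=\infty$. Here $V(G)$ and $E(G)$ denote vertex and edge sets; each graph carries its path metric (ignoring orientations). The edge number is $e(\mathcal{G})=\liminf_{n\to\infty}\frac{|E(G_n)|}{|V(G_n)|}$. For graph sequences write $\mathcal{G}\simeq\mathcal{H}$ if $V(G_n)=V(H_n)$ for all $n$ and there is $L>0$ (independent of $n$) such that for all $n$ the identity map $V(G_n)\to V(H_n)$ is $L$-bi-Lipschitz for the path metrics. The cost is $c(\mathcal{G})=\inf\{e(\mathcal{H}) : \mathcal{H}\text{ a graph sequence},\ \mathcal{H}\simeq\mathcal{G}\}$. For a subgroup $N\le\Gamma$ and a finite generating set $S$ of $\Gamma$, the Schreier graph $Sch(\Gamma,N,S)$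 has vertex set the right cosets $Ng$, $g\in\Gamma$, with a directed edge labelled $s$ from $Ng$ to $Ngs$ for each $s\in S$. $Cay(\Gamma,S)=Sch(\Gamma,\{1\},S)$ is the Cayley graph. A sequence of $S$-labelled finite graphs $G_n$ Benjamini–Schramm converges to $Cay(\Gamma,S)$ if for every $r\in\mathbb{N}$, the proportion of vertices $x\in V(G_n)$ such that the ball $B_r(G_n,x)$ is isomorphic, as a rooted edge-labelled (directed) graph, to the ball $B_r(Cay(\Gamma,S),e)$ around the identity tends to $1$ as $n\to\infty$. A sequence $(N_k)$ of finite index subgroups of $\Gamma$ (not necessarily normal, nested, or with trivial intersection) is a Farber sequence of $\Gamma$ if $Sch(\Gamma,N_k,S)$ Benjamini–Schramm converges to $Cay(\Gamma,S)$. *)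

(* Defs.v *)
From HB Require Import structures.
From mathcomp Require Export all_boot all_order all_algebra finmap.
From mathcomp Require Export mathcomp_extra boolp classical_sets functions.
From mathcomp Require Export cardinality reals ereal topology normedtype.
From mathcomp Require Export sequences.
Export Order.TTheory GRing.Theory Num.Theory.
Export numFieldNormedType.Exports.

Set Implicit Arguments.
Unset Strict Implicit.
Unset Printing Implicit Defensive.

Local Open Scope classical_set_scope.
Local Open Scope fset_scope.
Local Open Scope ring_scope.

(* Meaningful for finite sets only: [fset_set A] is empty if [A] is infinite. *)
Definition card (T : choiceType) (A : set T) : nat := #|` fset_set A |.

(* Directed multigraphs: loops and multiple edges are allowed, as they occur in
   Schreier graphs. Graphs with the same vertices are graphs over the same [V]. *)
Record graph (V : choiceType) := Graph {
  edge : choiceType;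
  src : edge -> V;
  tgt : edge -> V }.

Section Graph.
Variables (V : choiceType) (G : graph V).

Definition adj (x y : V) : Prop :=
  exists e : edge G, src e = x /\ tgt e = y \/ src e = y /\ tgt e = x.

Fixpoint walk (n : nat) (x y : V) : Prop :=
  if n is m.+1 then exists z, adj x z /\ walk m z y else x = y.

Definition connected_graph : Prop := forall x y, exists n, walk n x y.

(* The path metric; the value 0 for vertices in different components is
   irrelevant, as it is only used for connected graphs. *)
Definition dist (x y : V) : nat :=
  if pselect (exists n, `[< walk n x y >]) is left h then ex_minn h else 0.

(* A loop contributes 2. *)
Definition degree (x : V) : nat :=
  (card [set e : edge G | src e = x] + card [set e : edge G | tgt e = x])%N.

Definition finite_graph : Prop :=
  finite_set [set: V] /\ finite_set [set: edge G].

Definition ball_graph (r : nat) (x : V) : set V :=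
  [set y | exists2 n, (n <= r)%N & walk n x y].

End Graph.

Record graph_sequence (V : nat -> choiceType) (G : forall n, graph (V n)) :
    Prop := {
  gs_finite : forall n, finite_graph (G n);
  gs_connected : forall n, connected_graph (G n);
  gs_degree : exists d, forall n x, (degree (G n) x <= d)%N;
  gs_unbounded : card [set: V n] @[n --> \oo] --> \oo }.

Section Cost.
Variables (R : realType) (V : nat -> choiceType).
Implicit Types G H : forall n, graph (V n).

Definition edge_number G : \bar R :=
  limn_einf (fun n => ((card [set: edge (G n)])%:R / (card [set: V n])%:R)%:E).

Definition bilip_equiv G H : Prop :=
  exists2 L : R, 0 < L & forall n (x y : V n),
    L^-1 * (dist (G n) x y)%:R <= (dist (H n) x y)%:R <= L * (dist (G n) x y)%:R.

Definition cost G : \bar R :=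
  ereal_inf [set c | exists H,
    [/\ graph_sequence H, bilip_equiv H G & c = edge_number H]].

End Cost.

Record lgraph (L : Type) (V : choiceType) := LGraph {
  lgraph_graph :> graph V;
  label : edge lgraph_graph -> L }.

Section Induced.
Variables (L : Type) (V : choiceType) (G : lgraph L V) (A : set V).

Definition induced_edges : set (edge G) :=
  [set e | src e \in A /\ tgt e \in A].

Lemma induced_src (e : set_type induced_edges) : src (val e) \in A.
Proof. by have := valP e; rewrite in_setE => -[]. Qed.

Lemma induced_tgt (e : set_type induced_edges) : tgt (val e) \in A.
Proof. by have := valP e; rewrite in_setE => -[]. Qed.

Definition induced : lgraph L (set_type A) :=
  @LGraph L (set_type A)
    (@Graph (set_type A) (set_type induced_edges)
       (fun e => exist _ (src (val e)) (induced_src e))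
       (fun e => exist _ (tgt (val e)) (induced_tgt e)))
    (fun e => label (val e)).

End Induced.

Definition rooted_iso (L : Type) (V W : choiceType)
    (G : lgraph L V) (x : V) (H : lgraph L W) (y : W) : Prop :=
  exists (f : V -> W) (g : edge G -> edge H),
    [/\ bijective f, bijective g, f x = y
      & forall e, [/\ src (g e) = f (src e), tgt (g e) = f (tgt e)
                    & label (g e) = label e]].

Lemma ball_center (L : Type) (V : choiceType) (G : lgraph L V) r (x : V) :
  x \in ball_graph G r x.
Proof. by rewrite in_setE; exists 0. Qed.

(* Balls are induced subgraphs: they contain all edges of [G] between any two of
   their vertices, including those on the boundary sphere. *)
Definition ball_iso (L : Type) (V W : choiceType) (r : nat)
    (G : lgraph L V) (x : V) (H : lgraph L W) (y : W) : Prop :=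
  @rooted_iso L (set_type (ball_graph G r x)) (set_type (ball_graph H r y))
    (induced G (ball_graph G r x)) (exist _ x (ball_center G r x))
    (induced H (ball_graph H r y)) (exist _ y (ball_center H r y)).

Definition BS_cvg (R : realType) (L : Type) (V : nat -> choiceType)
    (G : forall n, lgraph L (V n)) (W : choiceType) (H : lgraph L W) (o : W) :
    Prop :=
  forall r : nat,
    ((card [set x | ball_iso r (G n) x H o])%:R / (card [set: V n])%:R : R)
      @[n --> \oo] --> (1 : R).

Section Subgroup.
Variables (Gamma : groupType) (K : groupClosed Gamma).

Definition subgroup : Type := {x : Gamma | x \in K}.

HB.instance Definition _ := SubChoice.on subgroup.

Lemma subgroup_closed : group_closed K.
Proof. by split; [exact: gpred1 | exact: gpredF]. Qed.

HB.instance Definition _ :=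
  SubChoice_isSubGroup.Build Gamma (fun x => x \in K) subgroup subgroup_closed.

Section Restriction.
Variable H : groupClosed Gamma.

(* The intersection of [H] and [K], as a subgroup of the group [K]. *)
Definition in_subgroup : {pred subgroup} := [pred x | val x \in H].

Lemma in_subgroup1 : 1%g \in in_subgroup.
Proof. by rewrite inE /= gpred1. Qed.

Lemma in_subgroupM : mulg_closed in_subgroup.
Proof. by move=> x y; rewrite !inE /= => xH yH; rewrite gpredM. Qed.

Lemma in_subgroupV : invg_closed in_subgroup.
Proof. by move=> x; rewrite !inE /= => xH; rewrite gpredV. Qed.

(* [isMul1Closed] has to come last, for the [groupClosed] instance to be found. *)
HB.instance Definition _ := isMulClosed.Build subgroup in_subgroup in_subgroupM.
HB.instance Definition _ := isInvClosed.Build subgroup in_subgroup in_subgroupV.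
HB.instance Definition _ := isMul1Closed.Build subgroup in_subgroup in_subgroup1.

End Restriction.
End Subgroup.

Arguments in_subgroup {Gamma} K H _.

Section Trivial.
Variable Gamma : groupType.

Definition trivial_subgroup : {pred Gamma} := pred1 1%g.

Lemma trivial_subgroup1 : 1%g \in trivial_subgroup.
Proof. by rewrite inE. Qed.

Lemma trivial_subgroupM : mulg_closed trivial_subgroup.
Proof. by move=> x y; rewrite !inE => /eqP-> /eqP->; rewrite mul1g. Qed.

Lemma trivial_subgroupV : invg_closed trivial_subgroup.
Proof. by move=> x; rewrite !inE => /eqP->; rewrite invg1. Qed.

HB.instance Definition _ :=
  isMulClosed.Build Gamma trivial_subgroup trivial_subgroupM.
HB.instance Definition _ :=
  isInvClosed.Build Gamma trivial_subgroup trivial_subgroupV.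
HB.instance Definition _ :=
  isMul1Closed.Build Gamma trivial_subgroup trivial_subgroup1.

End Trivial.

Arguments trivial_subgroup : clear implicits.

Section Cosets.
Variables (Gamma : groupType) (N : groupClosed Gamma).

Definition rcoset (g : Gamma) : set Gamma :=
  [set (x * g)%g | x in [set x | x \in N]].

Definition rcosets : set (set Gamma) := range rcoset.

Definition finite_index : Prop := finite_set rcosets.

Definition group_index : nat := card rcosets.

Definition normal_subgroup : Prop :=
  forall x g : Gamma, x \in N -> (x ^ g)%g \in N.

Lemma rcoset_in (g : Gamma) : rcoset g \in rcosets.
Proof. by rewrite in_setE; exists g. Qed.

Definition rcoset_vertex (g : Gamma) : set_type rcosets :=
  exist _ (rcoset g) (rcoset_in g).

Lemma rcosets_mulr (A : set_type rcosets) (s : Gamma) :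
  [set (x * s)%g | x in val A] \in rcosets.
Proof.
have := valP A; rewrite !in_setE => -[g _ <-]; exists (g * s)%g => //.
rewrite /rcoset image_comp; apply: eq_imagel => x _ /=; exact: mulgA.
Qed.

Definition rcoset_mulr (A : set_type rcosets) (s : Gamma) : set_type rcosets :=
  exist _ [set (x * s)%g | x in val A] (rcosets_mulr A s).

End Cosets.

Definition generates (Gamma : groupType) (S : {fset Gamma}) : Prop :=
  forall K : groupClosed Gamma, {subset S <= K} -> forall g : Gamma, g \in K.

Definition finitely_generated (Gamma : groupType) : Prop :=
  exists S : {fset Gamma}, generates S.

Definition residually_finite (Gamma : groupType) : Prop :=
  forall g : Gamma, g <> 1%g ->
    exists K : groupClosed Gamma,
      [/\ normal_subgroup K, finite_index K & g \notin K].

Section Schreier.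
Variables (Gamma : groupType) (N : groupClosed Gamma) (S : {fset Gamma}).

Definition Sch : lgraph S (set_type (rcosets N)) :=
  @LGraph S (set_type (rcosets N))
    (@Graph (set_type (rcosets N)) (set_type (rcosets N) * S)%type
       (fun e => e.1) (fun e => rcoset_mulr e.1 (val e.2)))
    (fun e => e.2).

End Schreier.

Definition Cay (Gamma : groupType) (S : {fset Gamma}) :=
  @Sch Gamma (trivial_subgroup Gamma) S.

(* Whether the Schreier graphs converge does not depend on the finite generating
   set, so being Farber is stated as a property of the subgroups alone. *)
Definition Farber (R : realType) (Gamma : groupType)
    (N : nat -> groupClosed Gamma) : Prop :=
  (forall k, finite_index (N k)) /\
  exists2 S : {fset Gamma}, generates S &
    BS_cvg R (fun k => Sch (N k) S) (Cay S)
      (@rcoset_vertex Gamma (trivial_subgroup Gamma) 1%g).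

(* Main.v *)
(* The Schreier graphs of Lambda sit inside those of Gamma: with t a transversal
   of Lambda in Gamma, N g |-> N g t(g)^-1 retracts N\Gamma onto N\Lambda with
   fibres of size d = [Gamma : Lambda], and moves points by a bounded distance.
   A graph H' equivalent to H on N\Lambda extends to a graph G' equivalent to G by
   attaching each remaining vertex as a leaf to its retraction. Conversely, given
   G' equivalent to G, every vertex outside N\Lambda has a G'-neighbour that is
   closer to N\Lambda; contracting the resulting forest, whose trees have bounded
   size, gives H' equivalent to H. Both times
   |E(G')| - |E(H')| = (d - 1) |N\Lambda|, so that e(H') = d e(G') + 1 - d. *)
From HB Require Import structures.
Require Import Defs.
From mathcomp Require Import zify ring.

Set Implicit Arguments.
Unset Strict Implicit.
Unset Printing Implicit Defensive.

Local Open Scope classical_set_scope.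

(** * Cardinals of finite sets *)

Lemma finite_set_inj (T U : Type) (f : T -> U) (A : set T) (B : set U) :
  finite_set B -> {in A &, injective f} -> f @` A `<=` B -> finite_set A.
Proof.
move=> finB fI fAB; rewrite -(eq_finite_set (inj_card_eq fI)).
exact: sub_finite_set finB.
Qed.

Lemma leq_card_inj (T U : choiceType) (f : T -> U) (A : set T) (B : set U) :
  finite_set B -> {in A &, injective f} -> f @` A `<=` B ->
  (card A <= card B)%N.
Proof.
move=> finB fI fAB; rewrite /card.
have finA := finite_set_inj finB fI fAB.
have <- : #|` (f @` fset_set A)%fset| = #|` fset_set A|; first rewrite card_in_imfset //.
  by move=> x y; rewrite !in_fset_set // => xA yA; apply: fI.
apply: fsubset_leq_card; apply/fsubsetP => y /imfsetP[x /= xA ->].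
rewrite in_fset_set // in_setE; apply: fAB; exists x => //.
by move: xA; rewrite in_fset_set // in_setE.
Qed.

Lemma leq_card_sub (T : choiceType) (A B : set T) :
  finite_set B -> A `<=` B -> (card A <= card B)%N.
Proof. by move=> finB AB; apply: (@leq_card_inj _ _ id) => //; rewrite image_id. Qed.

Lemma card_inj_image (T U : choiceType) (f : T -> U) (A : set T) :
  finite_set A -> {in A &, injective f} -> card (f @` A) = card A.
Proof.
move=> finA fI; rewrite /card fset_set_image // card_in_imfset //=.
by move=> x y; rewrite !in_fset_set // => xA yA; apply: fI.
Qed.

Lemma leq_card_setU (T : choiceType) (A B : set T) :
  finite_set A -> finite_set B -> (card (A `|` B) <= card A + card B)%N.
Proof. by move=> fA fB; rewrite /card fset_setU // cardfsU leq_subr. Qed.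

Lemma card_setU (T : choiceType) (A B : set T) :
  finite_set A -> finite_set B -> A `&` B = set0 ->
  card (A `|` B) = (card A + card B)%N.
Proof.
move=> fA fB AB0; rewrite /card fset_setU // cardfsU -fset_setI // AB0.
by rewrite fset_set0 cardfs0 subn0.
Qed.

Lemma card_setC (T : choiceType) (A : set T) :
  finite_set [set: T] -> (card A + card (~` A))%N = card [set: T].
Proof.
move=> finT; have fin (B : set T) : finite_set B by exact: (sub_finite_set (@subsetT _ _) finT).
by rewrite -card_setU ?setUv // setICr.
Qed.

Lemma finite_set_type (T : choiceType) (A : set T) :
  finite_set A -> finite_set [set: set_type A].
Proof.
move=> finA; apply: (finite_set_inj (f := val) finA).
  by move=> x y _ _; exact: val_inj.
by move=> _ [y _ <-]; have := valP y; rewrite in_setE.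
Qed.

Lemma card_set_type (T : choiceType) (A : set T) :
  finite_set A -> card [set: set_type A] = card A.
Proof.
move=> finA; rewrite -(card_inj_image (f := val) (finite_set_type finA)).
  congr card; rewrite predeqE => x; split=> [[y _ <-]|Ax].
    by have := valP y; rewrite in_setE.
  by exists (exist _ x (mem_set Ax)).
by move=> x y _ _; exact: val_inj.
Qed.

Lemma finite_setT_sum (T U : choiceType) :
  finite_set [set: T] -> finite_set [set: U] -> finite_set [set: T + U].
Proof.
move=> finT finU.
rewrite (_ : [set: T + U] = inl @` [set: T] `|` inr @` [set: U]).
  by rewrite finite_setU; split; exact: finite_image.
by rewrite predeqE => -[x|x]; split=> // _; [left|right]; exists x.
Qed.

Lemma card_sum (T U : choiceType) (A : set (T + U)) :
  finite_set [set: T] -> finite_set [set: U] ->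
  card A = (card (inl @^-1` A) + card (inr @^-1` A))%N.
Proof.
move=> finT finU.
have fT (B : set T) : finite_set B by exact: (sub_finite_set (@subsetT _ _) finT).
have fU (B : set U) : finite_set B by exact: (sub_finite_set (@subsetT _ _) finU).
rewrite -[X in (X + _)%N](card_inj_image (f := inl : T -> T + U)) //; last by move=> x y _ _ [].
rewrite -[X in (_ + X)%N](card_inj_image (f := inr : U -> T + U)) //; last by move=> x y _ _ [].
rewrite -card_setU; [|exact: finite_image|exact: finite_image|].
  congr card; rewrite predeqE => -[x|x]; split=> [Ax|].
  - by left; exists x.
  - by case=> [[y Ay [<-]]|[y]].
  - by right; exists x.
  - by case=> [[y]|[y Ay [<-]]].
by rewrite -subset0 => _ [[x _ <-] [y _]].
Qed.

Lemma size_fibres (T : Type) (U : eqType) (f : T -> U) (s : seq T) (t : seq U) :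
  uniq t -> all (fun x => f x \in t) s ->
  size s = (\sum_(y <- t) count (fun x => f x == y) s)%N.
Proof.
move=> ut; elim: s => [|x s IHs] /=; first by rewrite big1.
move=> /andP[xt /IHs ->]; rewrite big_split /= -[_.+1]add1n; congr (_ + _)%N.
transitivity (count_mem (f x) t); first by rewrite count_uniq_mem // xt.
elim: t {ut IHs xt} => [|y t IHt]; first by rewrite big_nil.
by rewrite big_cons /= IHt eq_sym.
Qed.

Lemma card_fibres (T U : choiceType) (f : T -> U) (A : set T) (B : set U) :
  finite_set A -> finite_set B -> f @` A `<=` B ->
  card A = (\sum_(y <- fset_set B) card (A `&` [set x | f x = y]))%N.
Proof.
move=> finA finB fAB.
rewrite /card (size_fibres (f := f) (t := fset_set B)) //; last first.
  apply/allP => x; rewrite in_fset_set // in_setE => Ax.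
  by rewrite in_fset_set // in_setE; apply: fAB; exists x.
apply: eq_bigr => y _; rewrite -size_filter.
apply/perm_size/uniq_perm => //; first by rewrite filter_uniq.
move=> x; rewrite mem_filter !in_fset_set //; last by apply: sub_finite_set finA => z [].
apply/idP/idP.
  by move=> /andP[/eqP fx]; rewrite !in_setE => Ax; split.
by rewrite in_setE => -[Ax /= ->]; rewrite eqxx in_setE.
Qed.

Lemma leq_card_fibres (T U : choiceType) (f : T -> U) (A : set T) (B : set U) k :
  finite_set A -> finite_set B -> f @` A `<=` B ->
  (forall y, card (A `&` [set x | f x = y]) <= k)%N -> (card A <= k * card B)%N.
Proof.
move=> finA finB fAB kP; rewrite (card_fibres finA finB fAB).
have -> : (k * card B = \sum_(y <- fset_set B) k)%N; last exact: leq_sum.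
by rewrite big_const_seq count_predT iter_addn_0.
Qed.

Lemma card_fibres_const (T U : choiceType) (f : T -> U) k :
  finite_set [set: T] -> finite_set [set: U] ->
  (forall y, card [set x | f x = y] = k) ->
  card [set: T] = (k * card [set: U])%N.
Proof.
move=> finT finU kP; rewrite (card_fibres (f := f) finT finU) //.
under eq_bigr do rewrite setTI kP.
by rewrite big_const_seq count_predT iter_addn_0.
Qed.

Lemma card_set_gt0 (T : choiceType) (A : set T) (x : T) :
  finite_set A -> A x -> (0 < card A)%N.
Proof.
move=> finA Ax; rewrite -(cardfs1 x) -fset_set1.
by apply: leq_card_sub => // _ ->.
Qed.

(** Source of the uniform Lipschitz constants: it will bound the word lengths of finitely many group
    elements. *)
Lemma finite_set_bounded (T : Type) (A : set T) (f : T -> nat) :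
  finite_set A -> exists M, forall x, A x -> (f x <= M)%N.
Proof.
move=> /(finite_image f)/finite_seqP[s fAs].
exists (\max_(m <- s) m)%N => x Ax.
have : (f @` A) (f x) by exists x.
by rewrite fAs => fx; exact: (@leq_bigmax_seq _ s xpredT id).
Qed.

(** * Path metrics and quasi-retractions *)

Section Walk.
Variables (V : choiceType) (G : graph V).

Lemma adj_sym x y : adj G x y -> adj G y x.
Proof. by case=> e [] [sx ty]; exists e; [right|left]. Qed.

Lemma walk_cat m n x y z : walk G m x y -> walk G n y z -> walk G (m + n) x z.
Proof.
elim: m x => [|m IHm] x /=; first by move=> ->.
by move=> [t [xt ty]] yz; exists t; split=> //; exact: IHm.
Qed.

Lemma walk1 x y : adj G x y -> walk G 1 x y.
Proof. by move=> xy; exists y. Qed.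

Lemma walk_sym n x y : walk G n x y -> walk G n y x.
Proof.
elim: n x => [|n IHn] x //= [z [xz /IHn yz]].
by rewrite -/(walk G n.+1 y x) -addn1; apply: walk_cat yz (walk1 (adj_sym xz)).
Qed.

Lemma dist_le n x y : walk G n x y -> (dist G x y <= n)%N.
Proof.
move=> xy; rewrite /dist; case: pselect => // h.
by case: ex_minnP => m _; apply; exact/asboolP.
Qed.

Hypothesis connG : connected_graph G.

Lemma walk_dist x y : walk G (dist G x y) x y.
Proof.
rewrite /dist; case: pselect => [h|[]]; first by case: ex_minnP => m /asboolP.
by have [n xy] := connG x y; exists n; exact/asboolP.
Qed.

Lemma distxx x : dist G x x = 0%N.
Proof. by apply/eqP; rewrite -leqn0; exact: dist_le. Qed.

Lemma dist_eq0 x y : dist G x y = 0%N -> x = y.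
Proof. by have := walk_dist x y => /[swap] ->. Qed.

Lemma dist_sym x y : dist G x y = dist G y x.
Proof. by apply/eqP; rewrite eqn_leq !dist_le //; apply/walk_sym/walk_dist. Qed.

Lemma dist_triangle y x z : (dist G x z <= dist G x y + dist G y z)%N.
Proof. by apply/dist_le/walk_cat; exact: walk_dist. Qed.

Lemma dist_adj x y : adj G x y -> (dist G x y <= 1)%N.
Proof. by move=> /walk1/dist_le. Qed.

End Walk.

Lemma walk_lipschitz (V W : choiceType) (G : graph V) (H : graph W)
    (f : V -> W) (M : nat) :
  connected_graph H ->
  (forall x y, adj G x y -> (dist H (f x) (f y) <= M)%N) ->
  forall n x y, walk G n x y -> (dist H (f x) (f y) <= M * n)%N.
Proof.
move=> connH fM; elim=> [|n IHn] x y /=; first by move=> ->; rewrite distxx.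
move=> [z [/fM xz /IHn zy]]; have := dist_triangle connH (f z) (f x) (f y); nia.
Qed.

Lemma dist_lipschitz (V W : choiceType) (G : graph V) (H : graph W)
    (f : V -> W) (M : nat) :
  connected_graph G -> connected_graph H ->
  (forall x y, adj G x y -> (dist H (f x) (f y) <= M)%N) ->
  forall x y, (dist H (f x) (f y) <= M * dist G x y)%N.
Proof. by move=> connG connH fM x y; exact: (walk_lipschitz connH fM (walk_dist connG x y)). Qed.

(* Up to the additive and multiplicative constant [M], the map [p] retracts [G]
   onto the copy of [H] carried by the image of [i]. *)
Record qretract (V W : choiceType) (G : graph V) (H : graph W)
    (i : W -> V) (p : V -> W) (M : nat) : Prop := QRetract {
  qr_connl : connected_graph G;
  qr_connr : connected_graph H;
  qr_K : cancel i p;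
  qr_i : forall w w', (dist G (i w) (i w') <= M * dist H w w')%N;
  qr_p : forall v v', (dist H (p v) (p v') <= M * dist G v v')%N;
  qr_near : forall v, (dist G v (i (p v)) <= M)%N }.

(** * Transfer of Lipschitz bounds between two quasi-retractions *)

Section Transfer.
Variables (V W : choiceType) (G G' : graph V) (H H' : graph W).
Variables (i : W -> V) (p p' : V -> W) (M M' C : nat).
Hypothesis (qr : qretract G H i p M).

(** The route from [v] to [v'] in [G] passes through [i (p v)] and [i (p v')]: each detour costs at
    most [M], and the middle piece is compared in turn with [H], [H'] and [G']. Both
    quasi-retractions share [p], so that the same points are measured in [H] and [H']. *)
Lemma qretract_dist_up : qretract G' H' i p M' ->
  (forall w w', dist H w w' <= C * dist H' w w')%N ->
  forall v v', (dist G v v' <= (2 * M + M * C * M') * dist G' v v')%N.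
Proof.
move=> qr' HC v v'.
(* Distinct vertices are at distance at least 1 in [G'], which absorbs the additive error [2 * M]
   into the multiplicative constant. *)
have [/(dist_eq0 (qr_connl qr')) ->|d_gt0] := posnP (dist G' v v').
  by rewrite distxx.
have h1 := dist_triangle (qr_connl qr) (i (p v)) v v'.
have h2 := dist_triangle (qr_connl qr) (i (p v')) (i (p v)) v'.
rewrite [dist _ (i (p v')) v'](dist_sym (qr_connl qr)) in h2.
have h3 := qr_near qr v; have h4 := qr_near qr v'.
have h5 := qr_i qr (p v) (p v').
have h6 := leq_mul (leqnn M) (HC (p v) (p v')).
have h7 := leq_mul (leqnn (M * C)%N) (qr_p qr' v v').
have h8 : (2 * M <= 2 * M * dist G' v v')%N by rewrite leq_pmulr.
rewrite !mulnA in h6 h7; rewrite mulnDl; lia.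
Qed.

(** Base points are compared through the common inclusion [i], which lifts them from [H'] to [G'],
    while [p] brings them down from [G] to [H]. The retractions may differ, as happens after a
    contraction. *)
Lemma qretract_dist_down : qretract G' H' i p' M' ->
  (forall v v', dist G v v' <= C * dist G' v v')%N ->
  forall w w', (dist H w w' <= M * C * M' * dist H' w w')%N.
Proof.
move=> qr' GC w w'.
have h1 := qr_p qr (i w) (i w'); rewrite !(qr_K qr) in h1.
have h2 := leq_mul (leqnn M) (GC (i w) (i w')).
have h3 := leq_mul (leqnn (M * C)%N) (qr_i qr' w w').
rewrite !mulnA in h2 h3; lia.
Qed.

End Transfer.

(** * Extension of a graph by leaves *)

Section Star.
Variables (V W : choiceType) (H : graph W) (i : W -> V) (p : V -> W).
Hypothesis (iK : cancel i p).

(* Every vertex [v] outside the image of [i] becomes a leaf at [i (p v)]. *)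
Definition star_graph : graph V :=
  @Graph V (edge H + set_type (~` range i))%type
    (fun e => match e with inl e => i (src e) | inr v => val v end)
    (fun e => match e with inl e => i (tgt e) | inr v => i (p (val v)) end).

Lemma star_walk n w w' : walk H n w w' -> walk star_graph n (i w) (i w').
Proof.
elim: n w => [|n IHn] w /=; first by move=> ->.
move=> [z [[e wz] zw']]; exists (i z); split; last exact: IHn.
by exists (inl e) => /=; case: wz => -[-> ->]; [left|right].
Qed.

Lemma star_walk_near v : exists2 n, (n <= 1)%N & walk star_graph n v (i (p v)).
Proof.
have [[w _ <-]|vi] := pselect (range i v); first by exists 0%N => //; rewrite /= iK.
exists 1%N => //; apply: walk1; exists (inr (exist _ v (mem_set vi))).
by left.
Qed.

Hypothesis (connH : connected_graph H).

Lemma star_connected : connected_graph star_graph.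
Proof.
move=> v v'; have [n pv] := connH (p v) (p v').
have [m _ vm] := star_walk_near v; have [m' _ vm'] := star_walk_near v'.
exists (m + (n + m'))%N; apply: walk_cat vm _.
by apply: walk_cat (star_walk pv) _; exact: walk_sym.
Qed.

(** The constant is 1: [i] maps edges to edges, and [p] maps these back to edges of [H] and
    collapses each leaf edge to a point. *)
Lemma star_qretract : qretract star_graph H i p 1.
Proof.
split=> //; first exact: star_connected.
- by move=> w w'; rewrite mul1n; apply/dist_le/star_walk/walk_dist.
- apply: dist_lipschitz => //; first exact: star_connected.
  move=> x y [[e|v] /=].
    by case=> -[<- <-]; rewrite !iK; apply: dist_adj; exists e; [left|right].
  by case=> -[<- <-]; rewrite !iK distxx.
- by move=> v; have [n n1 /dist_le vn] := star_walk_near v; exact: leq_trans n1.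
Qed.

Hypotheses (finV : finite_set [set: V]) (finH : finite_graph H).

Let finC (A : set V) : finite_set A.
Proof. exact: (sub_finite_set (@subsetT _ _) finV). Qed.

Lemma star_finite : finite_graph star_graph.
Proof.
split=> //; apply: finite_setT_sum; first exact: finH.2.
exact: finite_set_type.
Qed.

(** One leaf edge is added for each vertex outside the base; writing sums on both sides avoids
    truncated subtraction. *)
Lemma star_card :
  (card [set: edge star_graph] + card [set: W] =
   card [set: edge H] + card [set: V])%N.
Proof.
rewrite card_sum; [|exact: finH.2|exact: finite_set_type].
rewrite !preimage_setT card_set_type // -(card_setC (range i)) //.
rewrite card_inj_image; [lia|exact: finH.1|].
by move=> x y _ _; exact: (can_inj iK).
Qed.

(** At [v], edges coming from [H] contribute at most [d], the leaf edge issuing from [v] at most 1,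
    and leaf edges arriving at [v] at most [k], as their leaves lie in the fibre of [p] over
    [p v]. *)
Lemma star_degree d k :
  (forall w, degree H w <= d)%N -> (forall w, card [set v | p v = w] <= k)%N ->
  forall v, (degree star_graph v <= d + k.+1)%N.
Proof.
move=> Hd pk v; have := Hd (p v); have := pk (p v).
have finE := finH.2; have finS : finite_set [set: set_type (~` range i)].
  exact: finite_set_type.
have finCE (A : set (edge H)) : finite_set A.
  exact: (sub_finite_set (@subsetT _ _) finE).
rewrite /degree !card_sum //.
set a := card _ => ak; set b := card _; set c := card _ => bcd.
have le1 : (card (inl @^-1` [set e : edge star_graph | src e = v]) <= b)%N.
  by apply: leq_card_sub => // e /= <-; rewrite iK.
have le2 : (card (inl @^-1` [set e : edge star_graph | tgt e = v]) <= c)%N.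
  by apply: leq_card_sub => // e /= <-; rewrite iK.
have le3 : (card (inr @^-1` [set e : edge star_graph | src e = v]) <= 1)%N.
  rewrite -(cardfs1 v) -fset_set1.
  apply: (leq_card_inj (f := val)) => //.
    by move=> x y _ _; exact: val_inj.
  by move=> _ [x /= <- <-].
have le4 : (card (inr @^-1` [set e : edge star_graph | tgt e = v]) <= a)%N.
  apply: (leq_card_inj (f := val)) => //.
    by move=> x y _ _; exact: val_inj.
  by move=> _ [x /= <- <-] /=; rewrite iK.
lia.
Qed.

End Star.

(** * Contraction of a forest *)

Definition joins (V : choiceType) (G : graph V) (e : edge G) (x y : V) : Prop :=
  src e = x /\ tgt e = y \/ src e = y /\ tgt e = x.

(* [par] sends each vertex outside the base [range i] to a neighbour closer to the
   base, along the edge [pe v]. The edges [pe v] form a forest with exactly one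
   tree for each base vertex; contracting it keeps all the other edges. *)
Section Contract.
Variables (V W : choiceType) (G : graph V) (i : W -> V) (p : V -> W).
Variables (depth : V -> nat) (par : V -> V).
Variables (pe : set_type (~` range i) -> edge G) (D : nat).
Hypotheses (iK : cancel i p) (par_fix : forall w, par (i w) = i w).
Hypothesis par_depth : forall v, ~ range i v -> (depth (par v) < depth v)%N.
Hypothesis depth_le : forall v, (depth v <= D)%N.
Hypothesis pe_joins : forall v, joins (pe v) (val v) (par (val v)).

Let pnotin (v : set_type (~` range i)) : ~ range i (val v).
Proof. by have := valP v; rewrite in_setE. Qed.

(** Two distinct vertices with the same parent edge would be parents of each other, each of smaller
    depth than the other. *)
Lemma parent_edge_inj : injective pe.
Proof.
move=> u v uv; have := par_depth (@pnotin u); have := par_depth (@pnotin v).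
have := pe_joins u; have := pe_joins v; rewrite -uv /joins => -[] [-> ->] [] [e1 e2].
- by move=> _ _; apply: val_inj.
- by rewrite -e1 e2; lia.
- by rewrite e1 -e2; lia.
- by move=> _ _; apply: val_inj.
Qed.

(* Base vertices are fixed by [par], so [D] iterations, [D] being a bound on the
   depth, always end at the root of the tree of [v]. *)
Definition cluster (v : V) : W := p (iter D par v).

(** Only parent edges are discarded: other edges inside a tree survive as loops, and multiple edges
    are kept, which makes the edge count exact. *)
Definition contract_graph : graph W :=
  @Graph W (set_type (~` range pe))
    (fun e => cluster (src (val e))) (fun e => cluster (tgt (val e))).

Lemma iter_par_range n v : (depth v <= n)%N -> range i (iter n par v).
Proof.
elim: n v => [|n IHn] v dv; rewrite ?iterSr.
  by apply: contrapT => /par_depth; move: dv => /=; lia.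
have [[w _ <-]|/par_depth vi] := pselect (range i v).
  by rewrite par_fix iter_fix.
by apply: IHn; lia.
Qed.

Lemma i_cluster v : i (cluster v) = iter D par v.
Proof. by rewrite /cluster; have [w _ <-] := iter_par_range (depth_le v); rewrite iK. Qed.

Lemma cluster_i w : cluster (i w) = w.
Proof. by rewrite /cluster iter_fix. Qed.

(** After [D] iterations a root is reached, and [par] fixes it, so one more iteration changes
    nothing. *)
Lemma cluster_par v : cluster (par v) = cluster v.
Proof.
by rewrite /cluster -iterSr iterS; have [w _ <-] := iter_par_range (depth_le v); rewrite par_fix.
Qed.

Hypothesis connG : connected_graph G.

Lemma dist_iter_par n v : (dist G v (iter n par v) <= n)%N.
Proof.
elim: n => [|n IHn] /=; first by rewrite distxx.
set u := iter n par v in IHn *.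
have ad : (dist G u (par u) <= 1)%N.
  have [[w _ <-]|ui] := pselect (range i u); first by rewrite par_fix distxx.
  apply: dist_adj; exists (pe (exist _ u (mem_set ui))).
  by case: (pe_joins (exist _ u (mem_set ui))); [left|right].
by have := dist_triangle connG u v (par u); lia.
Qed.

Lemma dist_cluster v : (dist G v (i (cluster v)) <= D)%N.
Proof. by rewrite i_cluster; exact: dist_iter_par. Qed.

Lemma contract_adj v v' : adj G v v' ->
  cluster v = cluster v' \/ adj contract_graph (cluster v) (cluster v').
Proof.
move=> [e ev]; have [[u _ eu]|epe] := pselect (range pe e).
  left; have := pe_joins u; rewrite eu /joins.
  by move: ev => [] [<- <-] [] [-> ->]; rewrite cluster_par.
right; exists (exist _ e (mem_set epe)) => /=.
by case: ev => -[-> ->]; [left|right].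
Qed.

Lemma contract_connected : connected_graph contract_graph.
Proof.
move=> w w'; have [n] := connG (i w) (i w').
rewrite -[w in X in _ -> X]cluster_i -[w' in X in _ -> X]cluster_i.
elim: n (i w) => [|n IHn] v /=; first by move=> ->; exists 0%N.
move=> [z [/contract_adj[->|vz] /IHn //]] [m zw'].
by exists m.+1, (cluster z).
Qed.

(** An edge of the contraction comes from an edge of [G] whose ends lie within [D] of their roots,
    so these roots are at distance at most [2 * D + 1]; conversely, [cluster] does not increase
    distances. *)
Lemma contract_qretract : qretract G contract_graph i cluster (2 * D).+1.
Proof.
have connC := contract_connected; split=> //; first exact: cluster_i.
- apply: dist_lipschitz => // w w' [e ew].
  have connE : (dist G (src (val e)) (tgt (val e)) <= 1)%N.
    by apply: dist_adj; exists (val e); left.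
  have h1 := dist_cluster (src (val e)); have h2 := dist_cluster (tgt (val e)).
  have key : (dist G (i (cluster (src (val e)))) (i (cluster (tgt (val e)))) <= (2 * D).+1)%N.
    have h3 := dist_triangle connG (src (val e)) (i (cluster (src (val e))))
      (i (cluster (tgt (val e)))).
    have h4 := dist_triangle connG (tgt (val e)) (src (val e)) (i (cluster (tgt (val e)))).
    by rewrite [dist _ _ (src _)]dist_sym // in h3; lia.
  by case: ew => /= -[<- <-] //; rewrite dist_sym.
- apply: dist_lipschitz => // v v' /contract_adj[->|/dist_adj]; first by rewrite distxx.
  by lia.
- by move=> v; have := dist_cluster v; lia.
Qed.

Hypothesis finG : finite_graph G.

Let finV (A : set V) : finite_set A.
Proof. exact: (sub_finite_set (@subsetT _ _) finG.1). Qed.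

Let finE (A : set (edge G)) : finite_set A.
Proof. exact: (sub_finite_set (@subsetT _ _) finG.2). Qed.

Lemma finite_base : finite_set [set: W].
Proof.
by apply: (finite_set_inj (f := i) finG.1) => // x y _ _; exact: (can_inj iK).
Qed.

Lemma contract_finite : finite_graph contract_graph.
Proof. by split; [exact: finite_base|exact: finite_set_type]. Qed.

Lemma contract_card :
  (card [set: edge contract_graph] + card [set: V] =
   card [set: edge G] + card [set: W])%N.
Proof.
rewrite card_set_type // -(card_setC (range pe)) //.
rewrite card_inj_image; [|exact: finite_set_type|by move=> x y _ _; exact: parent_edge_inj].
rewrite card_set_type // -[card [set: V]](card_setC (range i)) //.
rewrite card_inj_image; [lia|exact: finite_base|].
by move=> x y _ _; exact: (can_inj iK).
Qed.

Variable d : nat.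
Hypothesis degG : forall v, (degree G v <= d)%N.

(** Distinct children outside the base are joined to [u] by distinct edges, at most [d] in number;
    the extra 1 is for [u] itself, which is its own parent if it lies in the base. *)
Lemma card_children u : (card [set v | par v = u] <= d.+1)%N.
Proof.
have sub : [set v | par v = u] `<=`
    [set u] `|` val @` [set v : set_type (~` range i) | par (val v) = u].
  move=> v /= vu; have [[w _ wv]|vi] := pselect (range i v).
    by left; rewrite /= -vu -wv par_fix.
  by right; exists (exist _ v (mem_set vi)).
apply: leq_trans (leq_card_sub _ sub) _ => //.
apply: leq_trans (leq_card_setU _ _) _ => //.
rewrite {1}/card fset_set1 cardfs1 add1n ltnS card_inj_image; last first.
- by move=> x y _ _; exact: val_inj.
- exact: (sub_finite_set (@subsetT _ _) (finite_set_type (finV _))).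
apply: leq_trans (degG u); apply: leq_trans _ (leq_card_setU _ _) => //.
apply: (leq_card_inj (f := pe)) => //.
  by move=> x y _ _; exact: parent_edge_inj.
move=> _ [v /= vu <-]; case: (pe_joins v) => -[sv tv]; [right|left].
  by rewrite /= tv vu.
by rewrite /= sv vu.
Qed.

(** Going back one step along [par] multiplies the number of vertices by at most [d.+1], and [D]
    steps reach the root. *)
Lemma card_cluster w : (card [set v | cluster v = w] <= d.+1 ^ D)%N.
Proof.
apply: (@leq_trans (card [set v | iter D par v = i w])).
  by apply: leq_card_sub => // v /= <-; rewrite i_cluster.
elim: D (i w) => [|n IHn] a.
  by rewrite expn0 -(cardfs1 a) -fset_set1; apply: leq_card_sub => // v /= ->.
rewrite expnS; apply: (@leq_trans (d.+1 * card [set v | iter n par v = a])).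
  apply: (leq_card_fibres (f := par)) => //.
    by move=> _ [v /= va <-]; rewrite -va -iterSr.
  move=> u; apply: leq_trans (card_children u).
  by apply: leq_card_sub => // v [].
by rewrite leq_mul2l IHn orbT.
Qed.

Lemma contract_degree w : (degree contract_graph w <= 2 * (d * d.+1 ^ D))%N.
Proof.
have bound (f : edge G -> V) : (forall v, card [set e | f e = v] <= d)%N ->
    (card [set e : set_type (~` range pe) | cluster (f (val e)) = w] <= d * d.+1 ^ D)%N.
  move=> fd; apply: (@leq_trans (card [set e | cluster (f e) = w])).
    apply: (leq_card_inj (f := val)) => //.
      by move=> x y _ _; exact: val_inj.
    by move=> _ [e /= <- <-].
  apply: (@leq_trans (d * card [set v | cluster v = w])); last first.
    by rewrite leq_mul2l card_cluster orbT.
  apply: (leq_card_fibres (f := f)) => // [_ [e ew <-] //|v].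
  by apply: leq_trans (fd v); apply: leq_card_sub => // e [].
rewrite mul2n -addnn leq_add //; apply: bound => v.
  exact: leq_trans (leq_addr _ _) (degG v).
exact: leq_trans (leq_addl _ _) (degG v).
Qed.

End Contract.

(** The depth is the distance to the base, and the parent is the next vertex on a shortest walk to
    the base. The new retraction [q] sends a vertex to the root of its tree, which may differ from
    its image under [p]. *)
Lemma exists_contraction (V W : choiceType) (G : graph V) (i : W -> V)
    (p : V -> W) (d D : nat) :
  finite_graph G -> connected_graph G -> (forall v, degree G v <= d)%N ->
  cancel i p -> (forall v, dist G v (i (p v)) <= D)%N ->
  exists (H : graph W) (q : V -> W),
    [/\ finite_graph H, qretract G H i q (2 * D).+1,
        forall w, (degree H w <= 2 * (d * d.+1 ^ D))%N &
        (card [set: edge H] + card [set: V] = card [set: edge G] + card [set: W])%N].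
Proof.
move=> finG connG degG iK near.
have depth_ex v : exists n, `[< exists w, walk G n v (i w) >].
  by exists (dist G v (i (p v))); apply/asboolP; exists (p v); exact: walk_dist.
pose depth v := ex_minn (depth_ex v).
have depthP v : exists w, walk G (depth v) v (i w).
  by rewrite /depth; case: ex_minnP => n /asboolP.
have depth_min n v w : walk G n v (i w) -> (depth v <= n)%N.
  by rewrite /depth; case: ex_minnP => m _ min vw; apply: min; apply/asboolP; exists w.
have /choice[par parP] v : exists z, (forall w, v = i w -> z = v) /\
    (~ range i v -> adj G v z /\ (depth z < depth v)%N).
  have [vi|vi] := pselect (range i v); first by exists v.
  have [w] := depthP v; case E : (depth v) => [|n] /=.
    by move=> vw; case: vi; exists w.
  move=> [z [vz zw]]; exists z; split=> [w' vw'|_]; first by case: vi; exists w'.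
  by split=> //; have := depth_min _ _ _ zw; lia.
have /choice[pe peP] (v : set_type (~` range i)) :
    exists e : edge G, joins e (val v) (par (val v)).
  have vi : ~ range i (val v) by have := valP v; rewrite in_setE.
  exact: ((parP (val v)).2 vi).1.
have par_fix w : par (i w) = i w by exact: (parP (i w)).1.
have par_depth v : ~ range i v -> (depth (par v) < depth v)%N.
  by move=> /(parP v).2[].
have depth_le v : (depth v <= D)%N.
  by apply: leq_trans (near v); exact/depth_min/walk_dist.
exists (contract_graph p par pe D), (cluster p par D); split.
- exact: (contract_finite par pe D iK finG).
- exact: (contract_qretract iK par_fix par_depth depth_le peP connG).
- exact: (contract_degree iK par_fix par_depth depth_le peP finG degG).
- exact: (contract_card D iK par_depth peP finG).
Qed.

(** * Schreier graphs *)

Section CosetTheory.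
Variables (Gamma : groupType) (N : groupClosed Gamma).
Implicit Types (A : set_type (rcosets N)) (g h : Gamma).

Lemma rcoset_vertexP A : exists g, rcoset_vertex N g = A.
Proof.
have := valP A; rewrite in_setE => -[g _ gA].
by exists g; apply: val_inj.
Qed.

Lemma rcoset_vertex_eq g h :
  rcoset_vertex N g = rcoset_vertex N h <-> (g * h^-1)%g \in N.
Proof.
split=> [/(congr1 val) /= gh|gh].
  have : rcoset N g g by exists 1%g; rewrite /= ?gpred1 ?mul1g.
  by rewrite gh => -[x /= xN <-]; rewrite mulgK.
apply: val_inj; rewrite predeqE => z /=; split=> -[x /= xN <-].
  exists (x * (g * h^-1))%g; first exact: gpredM.
  by rewrite -mulgA mulgVK.
exists (x * (g * h^-1)^-1)%g; first by apply: gpredM => //; rewrite gpredV.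
by rewrite invgM invgK -!mulgA mulVg mulg1.
Qed.

Lemma rcoset_vertex_mulr g h :
  rcoset_mulr (rcoset_vertex N g) h = rcoset_vertex N (g * h)%g.
Proof.
apply: val_inj; rewrite /= /rcoset image_comp; apply: eq_imagel => x _ /=.
by rewrite mulgA.
Qed.

Definition coset_repr A : Gamma := projT1 (cid (rcoset_vertexP A)).

Lemma coset_reprK A : rcoset_vertex N (coset_repr A) = A.
Proof. exact: projT2 (cid (rcoset_vertexP A)). Qed.

Lemma mem_coset_repr g : (coset_repr (rcoset_vertex N g) * g^-1)%g \in N.
Proof. by apply/rcoset_vertex_eq; exact: coset_reprK. Qed.

End CosetTheory.

(** * Word lengths valid in all Schreier graphs *)

Section Words.
Variables (Gamma : groupType) (S : {fset Gamma}).

(* The length of a word representing [g] serves for all Schreier graphs at once,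
   which makes the Lipschitz constants independent of the subgroup. *)
Definition uniform_walk (g : Gamma) (n : nat) : Prop :=
  forall (N : groupClosed Gamma) (h : Gamma),
    walk (Sch N S) n (rcoset_vertex N h) (rcoset_vertex N (h * g)%g).

(** As generation is expressed through subgroups, induction on words is replaced by showing that
    these elements form a subgroup containing [S]. *)
Definition reachable : {pred Gamma} := fun g => `[< exists n, uniform_walk g n >].

Lemma reachable1 : 1%g \in reachable.
Proof. by apply/asboolP; exists 0 => N h /=; rewrite mulg1. Qed.

Lemma reachableM : mulg_closed reachable.
Proof.
move=> x y /asboolP[m xm] /asboolP[n yn]; apply/asboolP.
by exists (m + n)%N => N h; apply: walk_cat (xm N h) _; rewrite mulgA; apply: yn.
Qed.

Lemma reachableV : invg_closed reachable.
Proof.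
move=> x /asboolP[n xn]; apply/asboolP; exists n => N h; apply: walk_sym.
by have := xn N (h * x^-1)%g; rewrite mulgVK.
Qed.

HB.instance Definition _ := isMulClosed.Build Gamma reachable reachableM.
HB.instance Definition _ := isInvClosed.Build Gamma reachable reachableV.
HB.instance Definition _ := isMul1Closed.Build Gamma reachable reachable1.

Hypothesis genS : generates S.

Lemma uniform_walk_ex g : exists n, uniform_walk g n.
Proof.
apply/asboolP; apply: (genS (K := reachable)) => s sS.
apply/asboolP; exists 1 => N h; apply: walk1.
by exists (rcoset_vertex N h, FSetSub sS); left; rewrite /= rcoset_vertex_mulr.
Qed.

Lemma Sch_connected (N : groupClosed Gamma) : connected_graph (Sch N S).
Proof.
move=> A B; rewrite -(coset_reprK A) -(coset_reprK B).
have [n] := uniform_walk_ex ((coset_repr A)^-1 * coset_repr B)%g.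
by move=> /(_ N (coset_repr A)); rewrite mulVKg; exists n.
Qed.

Definition word_bound (g : Gamma) : nat := projT1 (cid (uniform_walk_ex g)).

Lemma dist_word_bound (N : groupClosed Gamma) h g :
  (dist (Sch N S) (rcoset_vertex N h) (rcoset_vertex N (h * g)%g) <= word_bound g)%N.
Proof. exact: dist_le (projT2 (cid (uniform_walk_ex g)) N h). Qed.

Lemma Sch_lipschitz (N : groupClosed Gamma) (W : choiceType) (H : graph W)
    (f : set_type (rcosets N) -> W) (M : nat) :
  connected_graph H ->
  (forall h s, s \in S ->
    dist H (f (rcoset_vertex N h)) (f (rcoset_vertex N (h * s)%g)) <= M)%N ->
  forall A B, (dist H (f A) (f B) <= M * dist (Sch N S) A B)%N.
Proof.
move=> connH fM; apply: dist_lipschitz => //; first exact: Sch_connected.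
move=> x y [[A [s sS]] /= xy]; have := fM (coset_repr A) s sS.
rewrite -rcoset_vertex_mulr coset_reprK => fA.
by case: xy => -[<- <-]; rewrite // dist_sym.
Qed.

End Words.

(** * Retraction of cosets in [Gamma] onto cosets in [Lambda] *)

Section Subgroup.
Variables (Gamma : groupType) (Lambda : groupClosed Gamma).

(** Representatives are arbitrary except for the trivial coset, where 1 is imposed so that [residue]
    is the identity on [Lambda]. Finiteness of the range will give uniform word bounds. *)
Lemma exists_transversal : finite_index Lambda ->
  exists t : Gamma -> Gamma,
    [/\ forall g, (g / t g)%g \in Lambda,
        forall g h, (g / h)%g \in Lambda -> t g = t h,
        forall g, g \in Lambda -> t g = 1%g & finite_set (range t)].
Proof.
move=> finL.
have /choice[s sP] A : exists g, rcoset_vertex Lambda g = A /\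
    (A = rcoset_vertex Lambda 1%g -> g = 1%g).
  have [->|A1] := pselect (A = rcoset_vertex Lambda 1%g); first by exists 1%g.
  by exists (coset_repr A); rewrite coset_reprK.
exists (fun g => s (rcoset_vertex Lambda g)); split.
- move=> g; apply/rcoset_vertex_eq; by have [-> _] := sP (rcoset_vertex Lambda g).
- by move=> g h /rcoset_vertex_eq ->.
- move=> g gL; apply: (sP _).2; apply/rcoset_vertex_eq.
  by rewrite divg1.
- apply: (@sub_finite_set _ _ (range s)).
    by move=> _ [g _ <-]; exists (rcoset_vertex Lambda g).
  exact/finite_image/finite_set_type.
Qed.

Variable t : Gamma -> Gamma.
Hypothesis t_in : forall g, (g / t g)%g \in Lambda.
Hypothesis t_eq : forall g h, (g / h)%g \in Lambda -> t g = t h.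
Hypothesis t1 : forall g, g \in Lambda -> t g = 1%g.

Definition residue (g : Gamma) : subgroup Lambda := exist _ (g / t g)%g (t_in g).

Lemma val_residue g : val (residue g) = (g / t g)%g. Proof. by []. Qed.

Lemma t_mull l g : l \in Lambda -> t (l * g)%g = t g.
Proof. by move=> lL; apply: t_eq; rewrite mulgK. Qed.

Lemma t_mulr g s : t (t g * s)%g = t (g * s)%g.
Proof. by rewrite -(t_mull (t g * s)%g (t_in g)) divgKA. Qed.

(** A cocycle identity, whose second factor is a Schreier generator: it depends on [g] only through
    [t g], so a finite transversal and finitely many [s] yield finitely many factors. *)
Lemma residue_mulr g s : residue (g * s)%g = (residue g * residue (t g * s)%g)%g.
Proof.
apply: val_inj; rewrite valM !val_residue t_mulr.
by rewrite !mulgA mulgVK.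
Qed.

Lemma residue_val (h : subgroup Lambda) : residue (val h) = h.
Proof. by apply: val_inj; rewrite val_residue t1 ?divg1 //; exact: valP. Qed.

Section Cosets.
Variable N : groupClosed Gamma.
Hypothesis NL : {subset N <= Lambda}.

Local Notation NK := (in_subgroup Lambda N).

Lemma in_subgroup_div (g h : subgroup Lambda) :
  ((g / h)%g \in NK) = ((val g / val h)%g \in N).
Proof. by []. Qed.

Definition coset_incl (B : set_type (rcosets NK)) : set_type (rcosets N) :=
  rcoset_vertex N (val (coset_repr B)).

Definition coset_retr (A : set_type (rcosets N)) : set_type (rcosets NK) :=
  rcoset_vertex NK (residue (coset_repr A)).

Lemma coset_inclE h : coset_incl (rcoset_vertex NK h) = rcoset_vertex N (val h).
Proof.
apply/rcoset_vertex_eq; have := mem_coset_repr NK h.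
by rewrite in_subgroup_div.
Qed.

(** By [NL], elements of one coset of [N] lie in one coset of [Lambda]; hence they have the same
    [t], which cancels in the quotient of their residues. *)
Lemma coset_retrE g : coset_retr (rcoset_vertex N g) = rcoset_vertex NK (residue g).
Proof.
apply/rcoset_vertex_eq; have := mem_coset_repr N g.
set g' := coset_repr _ => gN; have tg : t g' = t g by apply/t_eq/NL.
by rewrite in_subgroup_div !val_residue tg (invgF g) divgKA.
Qed.

Lemma coset_inclK : cancel coset_incl coset_retr.
Proof.
move=> B; rewrite -(coset_reprK B) coset_inclE coset_retrE; congr rcoset_vertex.
exact: residue_val.
Qed.

(** Sending a coset of [N] to the coset of [Lambda] containing it is a bijection from the fibre to
    [rcosets Lambda]. *)
Lemma card_coset_retr_fibre (B : set_type (rcosets NK)) :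
  finite_index N -> card [set A | coset_retr A = B] = group_index Lambda.
Proof.
move=> finN; pose f (A : set_type (rcosets N)) := rcoset Lambda (coset_repr A).
have fE g : f (rcoset_vertex N g) = rcoset Lambda g.
  suff /(congr1 val) : rcoset_vertex Lambda (coset_repr (rcoset_vertex N g)) =
    rcoset_vertex Lambda g by [].
  by apply/rcoset_vertex_eq/NL/mem_coset_repr.
rewrite -(card_inj_image (f := f)).
- congr card; rewrite predeqE => X; split=> [[A _ <-]|[g _ <-]]; first by exists (coset_repr A).
  (* Surjectivity: if [h] represents [B], then [h * t g] has residue [h] and lies in the coset of
     [g]. *)
  exists (rcoset_vertex N (val (coset_repr B) * t g)%g).
    rewrite /= coset_retrE -[RHS](coset_reprK B); congr rcoset_vertex.
    have hL : val (coset_repr B) \in Lambda by exact: valP.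
    apply: val_inj; rewrite val_residue t_mull //.
    have -> : t (t g) = t g by have := t_mulr g 1%g; rewrite !mulg1.
    by rewrite mulgK.
  rewrite fE.
  suff /(congr1 val) : rcoset_vertex Lambda (val (coset_repr B) * t g)%g =
    rcoset_vertex Lambda g by [].
  apply/rcoset_vertex_eq; rewrite -mulgA gpredMl; last exact: valP.
  by rewrite gpredFC.
- by apply: (sub_finite_set (@subsetT _ _)); exact: finite_set_type.
(* Injectivity: a common coset of [Lambda] gives a common [t], so residues that agree modulo [N]
   come from elements that agree modulo [N]. *)
- move=> A A'; rewrite !in_setE /= => AB A'B; move: AB.
  rewrite -A'B -(coset_reprK A) -(coset_reprK A') !fE !coset_retrE.
  set a := coset_repr A; set a' := coset_repr A'.
  move=> /rcoset_vertex_eq; rewrite in_subgroup_div !val_residue => aa' LaLa'.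
  have /rcoset_vertex_eq/t_eq ta : rcoset_vertex Lambda a = rcoset_vertex Lambda a'.
    exact: val_inj.
  by apply/rcoset_vertex_eq; move: aa'; rewrite ta (invgF a') divgKA.
Qed.

Variables (S : {fset Gamma}) (S' : {fset subgroup Lambda}).
Hypotheses (genS : generates S) (genS' : generates S').
Variable M : nat.
Hypothesis M_S' : forall s', s' \in S' -> (word_bound genS (val s') <= M)%N.
Hypothesis M_S : forall g s, s \in S -> (word_bound genS' (residue (t g * s)%g) <= M)%N.
Hypothesis M_t : forall g, (word_bound genS (t g)^-1%g <= M)%N.

(** Three kinds of words are bounded: generators of [Lambda] written in [S] control the inclusion,
    Schreier generators written in [S'] the retraction, and inverses of the transversal the
    displacement of a vertex. *)
Lemma Sch_qretract : qretract (Sch N S) (Sch NK S') coset_incl coset_retr M.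
Proof.
have connG := @Sch_connected _ _ genS N; have connH := @Sch_connected _ _ genS' NK.
split=> //; first exact: coset_inclK.
- apply: (Sch_lipschitz genS') => // h s' s'S; rewrite !coset_inclE valM.
  exact: leq_trans (dist_word_bound _ _ _ _) (M_S' s'S).
- apply: (Sch_lipschitz genS) => // g s sS; rewrite !coset_retrE residue_mulr.
  exact: leq_trans (dist_word_bound _ _ _ _) (M_S _ sS).
- move=> A; rewrite -(coset_reprK A) coset_retrE coset_inclE val_residue.
  exact: leq_trans (dist_word_bound _ _ _ _) (M_t _).
Qed.

End Cosets.
End Subgroup.

(** * Cost *)

Local Open Scope ring_scope.

Lemma bilip_equivP (R : realType) (V : nat -> choiceType)
    (G H : forall n, graph (V n)) :
  bilip_equiv R G H <-> exists C : nat, forall n (x y : V n),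
    (dist (G n) x y <= C * dist (H n) x y)%N /\
    (dist (H n) x y <= C * dist (G n) x y)%N.
Proof.
split=> [[L L0 GH]|[C GH]].
  have LC := archi_boundP (ltW L0); exists (Num.bound L) => n x y.
  have /andP[] := GH n x y; rewrite ler_pdivrMl // => h1 h2.
  have h (a b : nat) : a%:R <= L * b%:R -> (a <= Num.bound L * b)%N.
    move=> ab; rewrite -(ler_nat R) natrM; apply: le_trans ab _.
    by rewrite ler_wpM2r // ltW.
  by split; exact: h.
(* The successor keeps the constant positive even if [C] is 0. *)
exists C.+1%:R; rewrite ?ltr0n // => n x y; have [h1 h2] := GH n x y.
by rewrite ler_pdivrMl ?ltr0n // -!natrM !ler_nat; apply/andP; split; nia.
Qed.

Lemma leq_cvgny (f g : nat -> nat) (C : nat) :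
  (forall n, (f n <= C * g n)%N) -> f n @[n --> \oo] --> \oo ->
  g n @[n --> \oo] --> \oo.
Proof.
move=> fg /cvgnyPge fy; apply/cvgnyPge => A.
have := fy (C * A).+1; apply: filterS => n; have := fg n; nia.
Qed.

Local Open Scope ereal_scope.

Lemma limn_einf_affine (R : realType) (a b : R) (u : nat -> \bar R) :
  (0 < a)%R ->
  limn_einf (fun n => a%:E * u n + b%:E) = a%:E * limn_einf u + b%:E.
Proof.
move=> a0; under eq_fun do rewrite addeC.
rewrite limn_einf_shift // addeC; congr (_ + _).
rewrite !limn_einf_lim; apply/cvg_lim => //.
rewrite (_ : einfs _ = (fun n => a%:E * einfs u n)).
  by apply: cvgeZl => //; exact: is_cvg_einfs.
rewrite funeqE => n /=; rewrite -ereal_inf_pZl //; congr ereal_inf.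
rewrite predeqE => x; split=> [[m mn <-]|[_ [m mn <-] <-]].
  by exists (u m) => //; exists m.
by exists m.
Qed.

Lemma ereal_inf_affine (R : realType) (a b : R) (X : set (\bar R)) :
  (0 < a)%R ->
  ereal_inf [set a%:E * x + b%:E | x in X] = a%:E * ereal_inf X + b%:E.
Proof.
move=> a0; rewrite -ereal_inf_pZl //; apply/eqP; rewrite eq_le; apply/andP; split.
  rewrite -leeBlDr //; apply: le_ereal_inf_tmp => _ [x Xx <-].
  by rewrite leeBlDr //; apply: ereal_inf_lbound; exists x.
apply: le_ereal_inf_tmp => _ [x Xx <-].
by rewrite leeD2r //; apply: ereal_inf_lbound; exists x.
Qed.

(** Infinite values are treated separately: a positive factor preserves their sign, so both sides
    are the same infinity. *)
Lemma affine_sub1 (R : realType) (a : R) (x : \bar R) :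
  (0 < a)%R -> a%:E * (x - 1) = a%:E * x + (1 - a)%:E - 1.
Proof.
move=> a0; case: x => [r| |]; first by rewrite -!EFinM -!EFinD; congr EFin; ring.
  by rewrite addye // gt0_muley ?lte_fin // !addye.
by rewrite addNye gt0_muleNy ?lte_fin // !addNye.
Qed.

(** * Comparison of costs along a quasi-retraction *)

Section Cost.
Variables (R : realType) (V W : nat -> choiceType).
Variables (G : forall n, graph (V n)) (H : forall n, graph (W n)).
Variables (i : forall n, W n -> V n) (p : forall n, V n -> W n) (M k : nat).
Arguments i : clear implicits.
Arguments p : clear implicits.
Hypothesis qr : forall n, qretract (G n) (H n) (i n) (p n) M.
Hypothesis finV : forall n, finite_set [set: V n].
Hypothesis cardW_gt0 : forall n, (0 < card [set: W n])%N.
Hypothesis k_gt0 : (0 < k)%N.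
Hypothesis fibres : forall n w, card [set v | p n v = w] = k.
Hypothesis cardV : card [set: V n] @[n --> \oo] --> \oo.

Let iK n : cancel (i n) (p n). Proof. exact: qr_K (qr n). Qed.

Let finW n : finite_set [set: W n].
Proof.
by apply: (finite_set_inj (f := i n) (finV n)) => // x y _ _; exact: (can_inj (@iK n)).
Qed.

Let card_base n : card [set: V n] = (k * card [set: W n])%N.
Proof. exact: card_fibres_const (@fibres n). Qed.

(** Dividing |E(H')| = |E(G')| + |W| - |V| by |W|, with |V| = k |W|, gives an affine relation
    between the edge densities; it passes to the lower limit as [k] is positive. *)
Let edge_number_base (G' : forall n, graph (V n)) (H' : forall n, graph (W n)) :
  (forall n, card [set: edge (H' n)] + card [set: V n] =
             card [set: edge (G' n)] + card [set: W n])%N ->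
  edge_number R H' = k%:R%:E * edge_number R G' + (1 - k%:R)%:E.
Proof.
move=> GH; rewrite -limn_einf_affine ?ltr0n //; congr limn_einf.
rewrite funeqE => n; rewrite -EFinM -EFinD; congr EFin.
have := congr1 (fun m => m%:R : R) (GH n).
rewrite !card_base !natrD natrM.
have W0 : ((card [set: W n])%:R != 0 :> R)%R by rewrite pnatr_eq0 -lt0n.
have k0 : (k%:R != 0 :> R)%R by rewrite pnatr_eq0 -lt0n.
move=> /(canRL (addrK _)) ->; field.
by rewrite W0 k0.
Qed.

Lemma cost_star (H' : forall n, graph (W n)) :
  graph_sequence H' -> bilip_equiv R H' H ->
  exists G' : forall n, graph (V n),
    [/\ graph_sequence G', bilip_equiv R G' G &
        edge_number R H' = k%:R%:E * edge_number R G' + (1 - k%:R)%:E].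
Proof.
move=> gsH' /bilip_equivP[C H'H].
pose G' n := star_graph (H' n) (i n) (p n).
have qr' n : qretract (G' n) (H' n) (i n) (p n) 1.
  exact: (star_qretract (@iK n) (@gs_connected _ _ gsH' n)).
exists G'; split.
- split=> // [n|n|].
  + exact: star_finite (finV n) (gs_finite gsH' n).
  + exact: qr_connl (qr' n).
  + have [d Hd] := gs_degree gsH'; exists (d + k.+1)%N => n.
    apply: star_degree => //; first exact: gs_finite gsH' n.
    by move=> w; rewrite fibres.
(* The sum of the constants for the two directions serves for both. *)
- apply/bilip_equivP; exists (2 * 1 + 1 * C * M + (2 * M + M * C * 1))%N => n x y.
  have h1 := qretract_dist_up (qr' n) (qr n) (fun w w' => (H'H n w w').1) x y.
  have h2 := qretract_dist_up (qr n) (qr' n) (fun w w' => (H'H n w w').2) x y.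
  by split; nia.
- apply: edge_number_base => n; rewrite -(star_card (@iK n)) //; exact: gs_finite gsH' n.
Qed.

Lemma cost_contract (G' : forall n, graph (V n)) :
  graph_sequence G' -> bilip_equiv R G' G ->
  exists H' : forall n, graph (W n),
    [/\ graph_sequence H', bilip_equiv R H' H &
        edge_number R H' = k%:R%:E * edge_number R G' + (1 - k%:R)%:E].
Proof.
move=> gsG' /bilip_equivP[C G'G]; have [d G'd] := gs_degree gsG'.
(* A displacement of at most [M] in [G] becomes one of at most [C * M] in [G']; this bounds the
   depth of the forest uniformly in [n]. *)
have near n v : (dist (G' n) v (i n (p n v)) <= C * M)%N.
  have := (G'G n v (i n (p n v))).1; have := qr_near (qr n) v; nia.
have ex n : exists HQ : graph (W n) * (V n -> W n),
   [/\ finite_graph HQ.1, qretract (G' n) HQ.1 (i n) HQ.2 (2 * (C * M)).+1,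
      forall w, (degree HQ.1 w <= 2 * (d * d.+1 ^ (C * M)))%N &
      (card [set: edge HQ.1] + card [set: V n] =
       card [set: edge (G' n)] + card [set: W n])%N].
  have [H' [q h]] := exists_contraction (gs_finite gsG' n) (@gs_connected _ _ gsG' n)
    (G'd n) (@iK n) (near n).
  by exists (H', q).
pose HQ n := projT1 (cid (ex n)); have HQP n := projT2 (cid (ex n)).
exists (fun n => (HQ n).1); split.
- split=> [n|n||]; first by have [] := HQP n.
  + by have [_ /qr_connr] := HQP n.
  + by exists (2 * (d * d.+1 ^ (C * M)))%N => n; have [] := HQP n.
  + by apply: (@leq_cvgny _ _ k _ cardV) => n; rewrite -card_base.
- apply/bilip_equivP.
  exists (M * C * (2 * (C * M)).+1 + (2 * (C * M)).+1 * C * M)%N => n x y.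
  have [_ qr' _ _] := HQP n.
  have h1 := qretract_dist_down (qr n) qr' (fun w w' => (G'G n w w').2) x y.
  have h2 := qretract_dist_down qr' (qr n) (fun w w' => (G'G n w w').1) x y.
  by split; rewrite mulnDl; [exact: leq_trans h2 (leq_addl _ _)|
    exact: leq_trans h1 (leq_addr _ _)].
- by apply: edge_number_base => n; have [] := HQP n.
Qed.

(** The increasing affine map with slope [k] fixing 1 commutes with infima and carries the edge
    numbers admissible for [G] exactly onto those admissible for [H]; the two inclusions are
    [cost_contract] and [cost_star]. *)
Theorem cost_qretract : k%:R%:E * (cost R G - 1) = cost R H - 1.
Proof.
have k0 : (0 < k%:R :> R)%R by rewrite ltr0n.
rewrite affine_sub1 // /cost -ereal_inf_affine //; congr (ereal_inf _ - _).
rewrite predeqE => c; split=> [[_ [G' [gs bl ->]] <-]|[H' [gs bl ->]]].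
  by have [H' [gs' bl' e]] := cost_contract gs bl; exists H'; rewrite e.
have [G' [gs' bl' ->]] := cost_star gs bl.
by exists (edge_number R G') => //; exists G'.
Qed.

End Cost.

Theorem theorem0p9 (R : realType) (Gamma : groupType)
    (Lambda : groupClosed Gamma) (N : nat -> groupClosed Gamma)
    (S : {fset Gamma}) (S' : {fset subgroup Lambda}) :
  finitely_generated Gamma ->
  residually_finite Gamma ->
  finite_index Lambda ->
  Farber R N ->
  (forall k, {subset N k <= Lambda}) ->
  group_index (N k) @[k --> \oo] --> \oo ->
  generates S ->
  generates S' ->
  (group_index Lambda)%:R%:E * (cost R (fun k => Sch (N k) S) - 1) =
  cost R (fun k => Sch (in_subgroup Lambda (N k)) S') - 1.
Proof.
move=> _ _ finL [finN _] NL Ny genS genS'.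
have [t [t_in t_eq t1 t_fin]] := exists_transversal finL.
(* Only finitely many words occur, and none depends on the subgroup [N k], so one constant serves
   for every [k]. *)
have [M1 M1P] := finite_set_bounded (word_bound genS \o val) (finite_fset S').
have [M2 M2P] := finite_set_bounded
  (fun x : Gamma * Gamma => word_bound genS' (residue t_in (x.1 * x.2)%g))
  (finite_setX t_fin (finite_fset S)).
have [M3 M3P] := finite_set_bounded (fun g => word_bound genS g^-1%g) t_fin.
pose M := (M1 + M2 + M3)%N.
have qr k : qretract (Sch (N k) S) (Sch (in_subgroup Lambda (N k)) S')
    (@coset_incl _ Lambda (N k)) (coset_retr t_in (N := N k)) M.
  apply: (Sch_qretract t_eq t1 (@NL k)).
  - by move=> s' /M1P /= h; rewrite /M; lia.
  - move=> g s sS; have /= h := M2P (t g, s) (conj (ex_intro2 _ _ g I erefl) sS).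
    by rewrite /M; lia.
  - move=> g; have /= h := M3P (t g) (ex_intro2 _ _ g I erefl).
    by rewrite /M; lia.
have finV k : finite_set [set: set_type (rcosets (N k))] by exact: finite_set_type (finN k).
apply: (cost_qretract R qr finV).
- move=> k; apply: (@card_set_gt0 _ _ (rcoset_vertex _ 1%g)) => //.
  exact: (finite_set_inj (f := @coset_incl _ Lambda (N k)) (finV k) (in2W (can_inj (qr_K (qr k))))).
- by apply: (@card_set_gt0 _ _ (rcoset Lambda 1%g)) => //; exists 1%g.
- by move=> k B; exact: card_coset_retr_fibre.
- by apply: (@leq_cvgny _ _ 1 _ Ny) => k; rewrite mul1n card_set_type; last exact: finN.
Qed.
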